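(* Let $\mathbb{K}$ be a field of characteristic $0$, let $F(n)$ be a holonomic sequence of order $J>0$, and let $L=\sum_{i=0}^{J}a_i(n)\sigma^i\in\operatorname{ann}F(n)$ with $a_0(n)a_J(n)\ne0$. Suppose $\gcd(a_0(n),a_J(n+h))=1$ for every $h\in\mathbb{N}=\{0,1,2,\dots\}$ and $L$ is nondegenerated. If $p(n)\in\mathbb{K}[n]$ is a nonzero polynomial such that $p(n)F(n)$ is summable, then \[\deg p(n)\ge \deg L + C_L.\]
   Context: $\sigma$ is the shift operator, $L(F(n))=\sum_i a_i(n)F(n+i)$, $\operatorname{ann}F(n)=\{L\in\mathbb{K}[n][\sigma]:L(F(n))=0\}$, $F$ holonomic means $\operatorname{ann}F\neq\{0\}$, and the order of $F$ is the minimal order of a nonzero element of $\operatorname{ann}F$. A holonomic sequence $G(n)$ of order $J$ is summable if $G(n)=\Delta\big(\sum_{i=0}^{J-1}u_i(n)G(n+i)\big)$ for some $u_i(n)\in\mathbb{K}(n)$, with $\Delta=\sigma-1$. Adjoint: $L^*(x(n))=\sum_{i=0}^J a_i(n-i)x(n-i)$. Put $b_k(n)=\sum_{j=k}^{J}\binom{j}{k}a_{J-j}(n+j-J)$, $d=\deg L=\max_{0\le k\le J}\{\deg b_k(n)-k\}$, $f(s)=\sum_{k=0}^{J}[n^{d+k}](b_k(n))\,s^{\underline{k}}$ (coefficient of $n^{d+k}$ in $b_k$ times the falling factorial $s(s-1)\cdots(s-k+1)$), and $R_L=\{s\in\mathbb{N}:f(s)=0\}$; $L$ is nondegenerated if $R_L=\emptyset$.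 Continued zero index $C_L$: if $L^*(1)\neq0$ then $C_L=0$; otherwise $C_L$ is the positive integer with $L^*(n^{C_L})\neq 0$ and $L^*(n^i)=0$ for $0\le i\le C_L-1$. *)

(* Defs.v *)
From HB Require Import structures.
From mathcomp Require Import all_boot all_order all_algebra.
Set Implicit Arguments. Unset Strict Implicit. Unset Printing Implicit Defensive.
Import Order.TTheory GRing.Theory Num.Theory.
Local Open Scope ring_scope.

(* Sequences are F : nat -> K.  A recurrence operator
   L = sum_{i < size L} L`_i(n) sigma^i in K[n][sigma] is represented by
   its coefficient list L : seq {poly K}. *)

Section Holonomic.
Variable K : fieldType.

Definition opapply (L : seq {poly K}) (F : nat -> K) (n : nat) : K :=
  \sum_(i < size L) (L`_i).[n%:R] * F (n + i)%N.

Definition annihilates (L : seq {poly K}) (F : nat -> K) : Prop :=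
  forall n, opapply L F n = 0.

Definition op_zero (L : seq {poly K}) : bool := all (fun a => a == 0) L.

Definition holonomic_order (F : nat -> K) (J : nat) : Prop :=
  (exists L, ~~ op_zero L /\ (size L <= J.+1)%N /\ annihilates L F) /\
  (forall L, (size L <= J)%N -> annihilates L F -> op_zero L).

(* G holonomic of order J is summable: G(n) = Delta(sum_{i<J} u_i(n) G(n+i)),
   u_i = v_i / d in K(n) (common denominator d), the identity holding for all
   sufficiently large n (i.e. away from the finitely many poles). *)
Definition summable (G : nat -> K) : Prop :=
  exists J, holonomic_order G J /\
  exists (v : seq {poly K}) (d : {poly K}),
    d != 0 /\ (size v <= J)%N /\
    exists N, forall n, (N <= n)%N ->
      G n = \sum_(i < J) ((v`_i).[(n.+1)%:R] / d.[(n.+1)%:R] * G (n.+1 + i)%N)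
          - \sum_(i < J) ((v`_i).[n%:R] / d.[n%:R] * G (n + i)%N).

Definition ideg (p : {poly K}) : int := (size p)%:Z - 1.

Definition bcoef (a : seq {poly K}) (k : nat) : {poly K} :=
  let J := (size a).-1 in
  \sum_(k <= j < J.+1)
     ('C(j, k))%:R *: (a`_(J - j) \Po ('X - ((J - j)%N)%:R%:P)).

(* deg L = max_{0<=k<=J, b_k <> 0} (deg b_k - k)  (b_J = a_0 is nonzero) *)
Definition degL (a : seq {poly K}) : int :=
  let J := (size a).-1 in
  \big[Order.max/(ideg (bcoef a J) - J%:Z)]_(k < J.+1 | bcoef a k != 0)
     (ideg (bcoef a k) - k%:Z).

Definition falling (s k : nat) : K := \prod_(i < k) (s%:R - i%:R).

Definition icoef (p : {poly K}) (e : int) : K :=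
  if (0 <= e) then p`_(absz e) else 0.

Definition indpoly (a : seq {poly K}) (s : nat) : K :=
  let J := (size a).-1 in
  \sum_(k < J.+1) icoef (bcoef a k) (degL a + k%:Z) * falling s k.

Definition nondegenerated (a : seq {poly K}) : Prop :=
  forall s : nat, indpoly a s != 0.

Definition adj_pow (a : seq {poly K}) (m : nat) : {poly K} :=
  \sum_(i < size a) (a`_i \Po ('X - i%:R%:P)) * ('X - i%:R%:P) ^+ m.

Definition is_CL (a : seq {poly K}) (C : nat) : Prop :=
  adj_pow a C != 0 /\ forall i, (i < C)%N -> adj_pow a i = 0.

End Holonomic.

(* Main.v *)
Require Import Defs.
From HB Require Import structures.
From mathcomp Require Import all_boot all_order all_algebra.
From mathcomp Require Import ring.
Import Order.TTheory GRing.Theory Num.Theory.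
Local Open Scope ring_scope.

Set Implicit Arguments.
Unset Strict Implicit.

(** If [p F] is summable, minimality of the order of [F] makes the telescoping
    operator a left multiple of [L] over [K(n)], and taking adjoints gives a
    rational [c] with [L^*(c) = - p].  An extremal pole of [c] in a shift class
    is a root of [a_0], resp. of [a_J], so coprimality of [a_0] with all
    [a_J(n + h)] forces [c] to be a polynomial; this is phrased with gcds of the
    shifts of the denominator, which avoids roots in extensions of [K].
    Newton's formula rewrites [L^*] as [sum_k b_k(n) Delta^k sigma^(-J)], so the
    coefficient of [n^(deg L + s)] in [L^*(c)], [s = deg c], is
    [lc(c) f(s) <> 0].  Moreover [f(0) <> 0] gives [L^*(1) <> 0], i.e. [C = 0]. *)

(** * Polynomial shifts and triviality of the denominator *)

Section Shift.
Variable K : fieldType.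
Implicit Types (p q : {poly K}) (x y : K).

Definition shift x p : {poly K} := p \Po ('X + x%:P).

HB.instance Definition _ x := GRing.RMorphism.copy (shift x) (comp_poly ('X + x%:P)).

Lemma shiftD x y p : shift y (shift x p) = shift (x + y) p.
Proof.
rewrite /shift -comp_polyA comp_polyD comp_polyX comp_polyC polyCD.
by rewrite -addrA (addrC y%:P).
Qed.

Lemma shift0 p : shift 0 p = p.
Proof. by rewrite /shift addr0 comp_polyXr. Qed.

Lemma shiftN x p : shift (- x) p = p \Po ('X - x%:P).
Proof. by rewrite /shift polyCN. Qed.

Lemma shift_inj x : injective (shift x).
Proof.
by apply: (can_inj (g := shift (- x))) => p; rewrite shiftD subrr shift0.
Qed.

Lemma shift_eq0 x p : (shift x p == 0) = (p == 0).
Proof. by rewrite -{1}(rmorph0 (shift x)) (inj_eq (@shift_inj x)). Qed.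

Lemma horner_shift x p y : (shift x p).[y] = p.[y + x].
Proof. by rewrite horner_comp !hornerE. Qed.

Lemma coprimep_shift x p q : coprimep (shift x p) (shift x q) = coprimep p q.
Proof.
apply/idP/idP; last exact: coprimep_comp_poly.
move/(coprimep_comp_poly ('X + (- x)%:P)).
by rewrite -!/(shift _ _) !shiftD subrr !shift0.
Qed.

Lemma dvdp_shift x p q : p %| q -> shift x p %| shift x q.
Proof. by move/dvdpP => [t ->]; rewrite rmorphM dvdp_mull. Qed.

Lemma coprimep_prodr (I : Type) (r : seq I) (P : pred I) (G : I -> {poly K}) p :
  (forall i, P i -> coprimep p (G i)) ->
  coprimep p (\prod_(i <- r | P i) G i).
Proof.
move=> h; elim/big_rec: _ => [|i t Pi ht]; first exact: coprimep1.
by rewrite coprimepMr h.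
Qed.

(** For nonconstant [p] and [q], [r] is the resultant in X of p(X + Y) and q(X): where it does not
    vanish at Y = y, its Bezout relation specializes to one for [shift y p] and [q]. If one of them
    is constant, [r = 1] works. *)
Lemma coprimep_shift_generic p q : p != 0 -> q != 0 ->
  exists2 r : {poly K}, r != 0 & forall y, r.[y] != 0 -> coprimep (shift y p) q.
Proof.
move=> p0 q0.
have cst (g h : {poly K}) : g != 0 -> (size g <= 1)%N -> coprimep g h.
  move=> g0 /size1_polyC g1; move: g0; rewrite g1 polyC_eq0 => g0.
  by rewrite -[_%:P]mulr1 mul_polyC coprimepZl // coprime1p.
case: (leqP (size p) 1) => p1.
  exists 1; rewrite ?oner_eq0 // => y _.
  by apply: cst; rewrite ?shift_eq0 // size_comp_poly2 // size_XaddC.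
case: (leqP (size q) 1) => q1.
  by exists 1; rewrite ?oner_eq0 // => y _; rewrite coprimep_sym; apply: cst.
exists (sub_annihilant p q); first exact: sub_annihilant_neq0.
move=> y ry.
have [] := @resultant_in_ideal _ (poly_XaY p) q^:P;
  rewrite ?size_poly_XaY ?size_map_polyC //.
move=> [u v] /= _ /(congr1 (map_poly (horner_eval y))).
rewrite rmorphD !rmorphM /= map_polyC /= !map_comp_poly /= rmorphD /=.
rewrite map_polyX map_polyC /=.
rewrite -!map_poly_comp /=.
have evC (g : {poly K}) : map_poly (horner_eval y \o polyC) g = g.
  by apply: map_poly_id => c _ /=; rewrite /horner_eval hornerC.
rewrite !evC /horner_eval hornerX => E.
pose ev (g : {poly K}) := g.[y].
apply/Bezout_coprimepP; exists (map_poly ev u, map_poly ev v) => /=.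
by rewrite /shift -E -/(sub_annihilant p q) -[_%:P]mulr1 mul_polyC eqp_scale.
Qed.

Hypothesis Kchar0 : [pchar K] =i pred0.

Lemma exists_nat_nonroot p : p != 0 -> exists n : nat, p.[n%:R] != 0.
Proof.
move=> p0; have nat0 := (@pcharf0P K).1 Kchar0.
(* In characteristic 0 these are [size p] distinct elements, more than [p] has roots. *)
pose rs := [seq n%:R : K | n <- iota 0 (size p)].
have rs_uniq : uniq rs.
  rewrite map_inj_in_uniq ?iota_uniq // => i j _ _.
  wlog le_ij : i j / (i <= j)%N.
    by move=> W; case: (leqP i j) => [/W //|/ltnW/W W' /esym/W' ->].
  move/eqP; rewrite eq_sym -subr_eq0 -natrB // nat0 subn_eq0 => le_ji.
  by apply/eqP; rewrite eqn_leq le_ij.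
have : ~~ all (root p) rs.
  apply/negP => rt; have := max_poly_roots p0 rt rs_uniq.
  by rewrite size_map size_iota ltnn.
by case/allPn => x /mapP[n _ ->] nr; exists n.
Qed.

(** One [m] serves all [i < J] at once: it is chosen off the roots of the product of the first [J]
    translates of the resultant. *)
Lemma coprimep_shift_window p q (J : nat) : p != 0 -> q != 0 ->
  exists m : nat, forall i, (i < J)%N -> coprimep (shift (m + i)%:R p) q.
Proof.
move=> p0 q0; have [r r0 hr] := coprimep_shift_generic p0 q0.
have [|m] := @exists_nat_nonroot (\prod_(i < J) shift i%:R r).
  by apply/prodf_neq0 => i _; rewrite shift_eq0.
rewrite horner_prod => /prodf_neq0 nz; exists m => i iJ; apply: hr.
by have := nz (Ordinal iJ) isT; rewrite horner_shift natrD.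
Qed.

(* Each hypothesis lets a window of [J] consecutive shifts of [q] coprime to
   some fixed polynomial slide by one step, down to [q] itself: first for
   every [shift h aJ], then for [q]. *)
Lemma denominator_trivial (a0 aJ q : {poly K}) (J : nat) :
  (0 < J)%N -> aJ != 0 -> q != 0 ->
  (forall h : nat, coprimep a0 (shift h%:R aJ)) ->
  q %| a0 * \prod_(i < J) shift (- i.+1%:R) q ->
  q %| aJ * \prod_(i < J) shift i.+1%:R q ->
  size q = 1%N.
Proof.
move=> J0 aJ0 q0 co q_a0 q_aJ.
have slide (P : nat -> Prop) m : (forall i, (i < J)%N -> P (m + i)%N) ->
    (forall n, (forall i, (i < J)%N -> P (n.+1 + i)%N) -> P n) -> P 0%N.
  move=> W S; suff: forall i, (i < J)%N -> P (0 + i)%N by move/(_ 0%N J0).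
  elim: m W => // m IH W; apply: IH => -[|i] iJ; last first.
    by rewrite addnS -addSn; apply: W; exact: ltnW.
  by rewrite addn0; apply: S.
have q_aJh (h : nat) : coprimep (shift h%:R aJ) q.
  have aJh0 : shift h%:R aJ != 0 by rewrite shift_eq0.
  have [m W] := coprimep_shift_window J aJh0 q0.
  rewrite -[shift h%:R aJ]shift0.
  apply: (slide (fun n => coprimep (shift n%:R (shift h%:R aJ)) q) m W) => n Wn.
  (* The factor [a0] is handled by [co] at h + n; a factor [shift (- i.+1%:R) q], translated by i +
     1, falls back on the window [Wn]. *)
  apply: (coprimep_dvdl q_a0); rewrite coprimepMr; apply/andP; split.
    by rewrite coprimep_sym shiftD -natrD.
  apply: coprimep_prodr => i _.
  rewrite -(coprimep_shift i.+1%:R) !shiftD addNr shift0 -natrD addnS -addSn.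
  by have := Wn i (ltn_ord i); rewrite shiftD.
have q_q : q %| \prod_(i < J) shift i.+1%:R q.
  rewrite -(@Gauss_dvdpr _ _ aJ) // coprimep_sym -[aJ]shift0.
  exact: (q_aJh 0%N).
(* Self-coprimality means being a nonzero constant. *)
apply/eqP; rewrite -coprimepp -{1}[q]shift0.
have [m W] := @coprimep_shift_window q q J q0 q0.
apply: (slide (fun n => coprimep (shift n%:R q) q) m W) => n Wn.
rewrite coprimep_sym; apply: (coprimep_dvdl (dvdp_shift n%:R q_q)).
rewrite rmorph_prod /=; apply: coprimep_prodr => i _.
by rewrite coprimep_sym shiftD addrC -natrD addnS -addSn; apply: Wn.
Qed.

End Shift.

(** * Finite differences and the degree of the adjoint *)

Section Degree.
Variable K : fieldType.
Implicit Types (p q x y : {poly K}) (a : seq {poly K}).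

Definition fdiff y : {poly K} := shift 1 y - y.

Lemma iter_fdiffD k x y : iter k fdiff (x + y) = iter k fdiff x + iter k fdiff y.
Proof. by elim: k => //= k ->; rewrite /fdiff rmorphD /=; ring. Qed.

(** Expansion of (1 + fdiff)^j, by Pascal's rule. Binomials beyond [j] vanish, so the range [N] can
    be common to all [j], which later allows the sums over [j] and [k] to be exchanged. *)
Lemma shift_newton (N j : nat) y : (j < N)%N ->
  shift j%:R y = \sum_(k < N) 'C(j, k)%:R *: iter k fdiff y.
Proof.
case: N => // N; rewrite ltnS; elim: j y => [|j IH] y jN.
  rewrite shift0 big_ord_recl /= bin0 scale1r big1 ?addr0 // => i _.
  by rewrite bin0n scale0r.
rewrite -add1n natrD -shiftD.
rewrite [shift 1 y](_ : _ = y + fdiff y); last by rewrite /fdiff addrC subrK.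
rewrite IH ?(ltnW jN) //; under eq_bigr do rewrite iter_fdiffD scalerDr -iterSr.
rewrite big_split /= [X in _ + X]big_ord_recr /= (bin_small jN) scale0r addr0.
rewrite big_ord_recl [RHS]big_ord_recl /= !bin0 -addrA; congr (_ + _).
rewrite -big_split /=; apply: eq_bigr => i _.
by rewrite /bump /= !add1n binS natrD scalerDl.
Qed.

(** Only size bounds are assumed, so as to cover those [bcoef] whose degree is not extremal. *)
Lemma coefM_top p q (m n : nat) : (size p <= m.+1)%N -> (size q <= n.+1)%N ->
  (p * q)`_(m + n) = p`_m * q`_n.
Proof.
move=> sp sq; have mlt : (m < (m + n).+1)%N by rewrite ltnS leq_addr.
rewrite coefM (bigD1 (Ordinal mlt)) //= addKn big1 ?addr0 // => j jm.
have {}jm : j != m :> nat by apply: contra jm => /eqP e; apply/eqP/val_inj.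
have [jm'|mj] := ltnP j m; last first.
  by rewrite nth_default ?mul0r // (leq_trans sp) // ltn_neqAle eq_sym jm.
by rewrite [q`_ _]nth_default ?mulr0 // (leq_trans sq) // ltn_subRL ltn_add2r.
Qed.

(** Induction on the Horner form, through fdiff(qX + c) = fdiff(q) X + fdiff(q) + q. At [s = 0],
    where [s.-1] is 0, both sides of the coefficient equation vanish. *)
Lemma fdiff_top y (s : nat) : (size y <= s.+1)%N ->
  (size (fdiff y) <= s)%N /\ (fdiff y)`_s.-1 = s%:R * y`_s.
Proof.
elim/poly_ind: y s => [|q c IH] s sz.
  by rewrite /fdiff rmorph0 subrr size_poly0 !coef0 mulr0.
have dE : fdiff (q * 'X + c%:P) = fdiff q * 'X + fdiff q + q.
  rewrite /fdiff rmorphD rmorphM /= /shift comp_polyX comp_polyC; ring.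
have szq : (size q <= s)%N.
  have [->|q0] := eqVneq q 0; first by rewrite size_poly0.
  by move: sz; rewrite size_MXaddC (negbTE q0).
case: s szq {sz} => [|s] szq.
  move: szq; rewrite leqn0 size_poly_eq0 => /eqP q0.
  by rewrite dE q0 /fdiff rmorph0 subrr mul0r !addr0 size_poly0 coef0 mul0r.
have [sd cd] := IH s szq; rewrite dE; split.
  rewrite (leq_trans (size_polyD _ _)) // geq_max szq andbT.
  rewrite (leq_trans (size_polyD _ _)) // geq_max (leq_trans sd) // andbT.
  by rewrite (leq_trans (size_polyMleq _ _)) // size_polyX addn2.
move: (fdiff q) sd cd => d sd cd; rewrite !coefD !coefMX coefC /= addr0.
rewrite [X in _ + X + _]nth_default // addr0.
case: s cd {szq sd} => [|s] /= cd; first by rewrite add0r mul1r.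
by rewrite cd [in RHS]mulrS mulrDl mul1r addrC.
Qed.

Lemma iter_fdiff_top y (s k : nat) : (k <= s)%N -> (size y <= s.+1)%N ->
  (size (iter k fdiff y) <= (s - k).+1)%N /\
  (iter k fdiff y)`_(s - k) = falling K s k * y`_s.
Proof.
elim: k => [|k IH] ks sy; first by rewrite subn0 /falling big_ord0 mul1r.
have [sz ck] := IH (ltnW ks) sy; have [sz' ck'] := fdiff_top sz.
rewrite /= -subSn // subSS; split=> //.
rewrite subnS ck' ck /falling big_ord_recr /= natrB ?(ltnW ks) //; ring.
Qed.

Lemma iter_fdiff_eq0 y (s k : nat) : (s < k)%N -> (size y <= s.+1)%N ->
  iter k fdiff y = 0.
Proof.
move=> sk sy; apply/eqP; rewrite -size_poly_leq0 -(subnKC sk) addnC iterD.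
have : (size (iter s.+1 fdiff y) <= 0)%N.
  have [sz _] := iter_fdiff_top (leqnn s) sy.
  by have [] := fdiff_top (y := iter s fdiff y) (s := 0%N); rewrite ?subnn in sz *.
rewrite size_poly_leq0 => /eqP ->.
elim: (k - s.+1)%N => [|n IH] /=; first by rewrite size_poly0.
by move: IH; rewrite !size_poly_leq0 => /eqP ->; rewrite /fdiff rmorph0 subrr.
Qed.

Lemma falling_eq0 (s k : nat) : (s < k)%N -> falling K s k = 0.
Proof. by move=> sk; rewrite /falling (bigD1 (Ordinal sk)) //= subrr mul0r. Qed.

(** The operator [L^*] on arbitrary polynomials; [adj_pow] gives its values on monomials. *)
Definition adjoint a x : {poly K} := \sum_(i < size a) shift (- i%:R) (a`_i * x).

Lemma adjoint_pow a m : adj_pow a m = adjoint a 'X^m.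
Proof.
apply: eq_bigr => i _.
by rewrite rmorphM /= rmorphXn /= !shiftN comp_polyX.
Qed.

(** Each x(n - i) is Newton-expanded from the base point n - J with j = J - i steps; collecting the
    k-th differences produces exactly [bcoef a k]. *)
Lemma adjoint_bcoef a x (J : nat) : size a = J.+1 ->
  adjoint a x = \sum_(k < J.+1) bcoef a k * iter k fdiff (shift (- J%:R) x).
Proof.
move=> sa.
(* Starting the sum at 0 instead of [k] only adds terms with zero binomial coefficient. *)
have bE (k : nat) : bcoef a k =
    \sum_(j < J.+1) 'C(j, k)%:R *: shift (- (J - j)%:R) a`_(J - j).
  rewrite /bcoef sa /=; under eq_bigr do rewrite -shiftN.
  rewrite -(big_mkord xpredT (fun j =>
    'C(j, k)%:R *: shift (- (J - j)%:R) a`_(J - j))).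
  have [kJ|Jk] := leqP k J.+1.
    rewrite [RHS](big_cat_nat (n := k)) //= [X in _ = X + _]big_nat_cond.
    rewrite [X in _ = X + _]big1 ?add0r // => i.
    by rewrite andbT => /andP[_ ik]; rewrite bin_small // scale0r.
  rewrite big_geq ?(ltnW Jk) // big_nat_cond big1 // => i.
  by rewrite andbT => /andP[_ ik]; rewrite bin_small ?scale0r // (ltn_trans ik).
under [RHS]eq_bigr do rewrite bE mulr_suml.
rewrite exchange_big /= /adjoint sa (reindex_inj rev_ord_inj) /=.
apply: eq_bigr => j _; rewrite subSS rmorphM /=.
under [RHS]eq_bigr do rewrite -scalerAl scalerAr.
rewrite -mulr_sumr -shift_newton // shiftD; congr (_ * shift _ _).
by rewrite natrB ?opprB 1?addrC // -ltnS.
Qed.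

Lemma degL_bound a (D k : nat) : degL a = D%:Z -> (k <= (size a).-1)%N ->
  (size (bcoef a k) <= (D + k).+1)%N.
Proof.
move=> aD kJ; have [->|b0] := eqVneq (bcoef a k) 0; first by rewrite size_poly0.
have kJ' : (k < (size a).-1.+1)%N by [].
have := @le_bigmax_cond _ _ _ (ideg (bcoef a (size a).-1) - (size a).-1%:Z)
  (Ordinal kJ')  (fun i => bcoef a i != 0) (fun i => ideg (bcoef a i) - i%:Z) b0.
rewrite -/(degL a) aD /= /ideg lerBlDr lerBlDr -!PoszD.
by rewrite lez_nat addn1.
Qed.

(** Term [k] is a product of factors of degree at most D + k and s - k, so only their top
    coefficients reach the exponent D + s. For k > s the difference and the falling factorial both
    vanish. *)
Lemma coef_adjoint a x (J D s : nat) : size a = J.+1 -> degL a = D%:Z ->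
  size x = s.+1 -> (adjoint a x)`_(D + s) = lead_coef x * indpoly a s.
Proof.
move=> sa aD sx; rewrite (adjoint_bcoef x sa) coef_sum /indpoly sa /= mulr_sumr.
have szy : size (shift (- J%:R) x) = s.+1 by rewrite size_comp_poly2 // size_XaddC.
have lcy : (shift (- J%:R) x)`_s = lead_coef x.
  have -> : s = (size (shift (- J%:R) x)).-1 by rewrite szy.
  rewrite -/(lead_coef _) lead_coef_comp ?size_XaddC //.
  by rewrite -[(- _)%:P]opprK -polyCN lead_coefXsubC expr1n mulr1.
apply: eq_bigr => k _; have [ks|sk] := leqP k s; last first.
  by rewrite (iter_fdiff_eq0 sk) ?szy // falling_eq0 // !mulr0 coef0.
have [szk ck] := iter_fdiff_top ks (eq_leq szy).
have -> : (D + s = (D + k) + (s - k))%N by rewrite -addnA subnKC.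
rewrite coefM_top //; last by apply: degL_bound; rewrite // sa -ltnS.
rewrite ck lcy aD -PoszD /icoef /=; ring.
Qed.

(** At s = 0 only k = 0 survives in the indicial sum, and [icoef] is 0 at negative exponents; thus
    f(0) <> 0 excludes a negative [degL]. *)
Lemma nondegenerated_degL a (J : nat) : size a = J.+1 -> nondegenerated a ->
  {D : nat | degL a = D%:Z}.
Proof.
move=> sa nd; case E : (degL a) => [D|D]; first by exists D.
exfalso; move: (nd 0%N); rewrite /indpoly sa /= big_ord_recl E.
rewrite [X in _ + X]big1 ?addr0 => [|i _]; last by rewrite falling_eq0 // mulr0.
by rewrite /icoef /= mul0r eqxx.
Qed.

End Degree.

(** * Telescoping relations and rational solutions of the adjoint equation *)

Section Telescoper.
Variable K : fieldType.
Implicit Types (p q r : {poly K}) (a : seq {poly K}) (F : nat -> K).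

Local Notation "x %:F" := (@FracField.tofrac {poly K} x).

(** Serves to bound the order of p F by [J]. The relation for F is multiplied by the product of all
    p(n + j), j <= J, and [c i] is that product without p(n + i). *)
Lemma annihilates_mul_poly a F (J : nat) p :
  size a = J.+1 -> annihilates a F -> a`_J != 0 -> p != 0 ->
  exists L : seq {poly K}, [/\ size L = J.+1, ~~ op_zero L &
    annihilates L (fun n => p.[n%:R] * F n)].
Proof.
move=> sa aF aJ p0.
pose c (i : 'I_J.+1) := \prod_(j < J.+1 | j != i) shift j%:R p.
pose L := mkseq (fun i => a`_i * c (inord i)) J.+1; exists L.
have sL : size L = J.+1 by rewrite size_mkseq.
have LE (i : 'I_J.+1) : L`_i = a`_i * c i by rewrite nth_mkseq // inord_val.
split=> //.
  apply/negP => /(all_nthP 0)/(_ J); rewrite sL ltnSn => /(_ isT).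
  rewrite (LE ord_max) mulf_eq0 (negbTE aJ) /=; apply/negP.
  by apply/prodf_neq0 => i _; rewrite shift_eq0.
move=> n; rewrite /opapply sL.
transitivity ((\prod_(j < J.+1) (shift j%:R p)).[n%:R] * opapply a F n);
  last by rewrite aF mulr0.
rewrite /opapply sa mulr_sumr; apply: eq_bigr => i _.
rewrite LE [in RHS](bigD1 i) //= !hornerM horner_shift -natrD /c; ring.
Qed.

(** Cross-multiplication cancels the coefficient of F(n + J), leaving an annihilator of order below
    [J], which minimality forces to be zero. *)
Lemma minimal_annihilator_prop a F (J : nat) (m : nat -> {poly K}) :
  holonomic_order F J -> size a = J.+1 -> annihilates a F ->
  (forall n : nat, \sum_(i < J.+1) (m i).[n%:R] * F (n + i)%N = 0) ->
  forall i, (i <= J)%N -> a`_J * m i = m J * a`_i.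
Proof.
move=> [_ minJ] sa aF mF i; rewrite leq_eqVlt => /predU1P[->|iJ].
  by rewrite mulrC.
pose M := mkseq (fun i => a`_J * m i - m J * a`_i) J.
have sM : size M = J by rewrite size_mkseq.
have : op_zero M.
  apply: minJ; first by rewrite sM.
  move=> n; rewrite /opapply sM.
  have := aF n; have := mF n; rewrite /opapply sa !big_ord_recr /=.
  set A := \sum_(_ < _) _; set B := \sum_(_ < _) _ => hA hB.
  transitivity ((a`_J).[n%:R] * A - (m J).[n%:R] * B).
    rewrite /A /B !mulr_sumr -sumrB; apply: eq_bigr => j _.
    by rewrite nth_mkseq // !(hornerD, hornerN, hornerM); ring.
  have -> : A = - ((m J).[n%:R] * F (n + J)%N) by apply/eqP; rewrite -addr_eq0 hA.
  have -> : B = - ((a`_J).[n%:R] * F (n + J)%N) by apply/eqP; rewrite -addr_eq0 hB.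
  ring.
move/(all_nthP 0) => /(_ i); rewrite sM => /(_ iJ).
by rewrite nth_mkseq // subr_eq0 => /eqP.
Qed.

(** [m] lists the coefficients of the telescoping relation for F, moved to one side and multiplied
    by e(n) e(n + 1); [w i] absorbs the factor p(n + i) coming from p F. *)
Lemma summable_operator a F (J : nat) p :
  holonomic_order F J -> size a = J.+1 -> annihilates a F -> a`_J != 0 ->
  p != 0 -> summable (fun n => p.[n%:R] * F n) ->
  exists (w : nat -> {poly K}) (e : {poly K}) (m : nat -> {poly K}),
  [/\ e != 0, w J = 0,
    m 0%N = - (shift 1 e * w 0%N) - e * shift 1 e * p,
    (forall i, m i.+1 = e * shift 1 (w i) - shift 1 e * w i.+1) &
    forall i, (i <= J)%N -> a`_J * m i = m J * a`_i].
Proof.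
move=> ordF sa aF aJ p0 [J' [[_ minJ'] [v [e [e0 [sv [N GE]]]]]]].
have J'J : (J' <= J)%N.
  rewrite leqNgt; apply/negP => JJ'.
  have [L [sL /negP L0 LG]] := annihilates_mul_poly sa aF aJ p0.
  by apply: L0; apply: minJ' => //; rewrite sL.
have v0 i : (J' <= i)%N -> v`_i = 0.
  by move=> h; rewrite nth_default // (leq_trans sv).
pose w i := v`_i * shift i%:R p.
pose m i := (if i is j.+1 then e * shift 1 (w j) else 0) - shift 1 e * w i
            - (if i is 0%N then e * shift 1 e * p else 0).
exists w, e, m; split=> //.
- by rewrite /w v0 // mul0r.
- by rewrite /m sub0r.
- by move=> i; rewrite /m subr0.
(* The cleared relation is guaranteed only for n >= N off the zeros of e(n) e(n + 1). [T] vanishes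
   at all other n, so the coefficients [T * m i] annihilate F everywhere; [T] is cancelled at the
   end. *)
pose T := e * shift 1 e * \prod_(j < N) ('X - (j%:R)%:P).
have T0 : T != 0.
  rewrite !mulf_neq0 ?shift_eq0 //; apply/prodf_neq0 => j _; by rewrite polyXsubC_eq0.
have key : forall i, (i <= J)%N -> a`_J * (T * m i) = (T * m J) * a`_i.
  apply: (@minimal_annihilator_prop a F J (fun i => T * m i)) => // n.
  under eq_bigr do rewrite hornerM -mulrA.
  rewrite -mulr_sumr; apply/eqP; rewrite mulf_eq0.
  have [nN|Nn] := ltnP n N.
    rewrite hornerM horner_prod (bigD1 (Ordinal nN)) //= hornerXsubC.
    by rewrite subrr mul0r mulr0 eqxx.
  case en : (e.[n%:R] == 0); first by rewrite !hornerM (eqP en) !mul0r eqxx.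
  case en1 : ((shift 1 e).[n%:R] == 0).
    by rewrite !hornerM (eqP en1) mulr0 mul0r eqxx.
  apply/orP; right; move: en1; rewrite horner_shift natr1 => en1.
  have ext k : \sum_(i < J') (v`_i).[k%:R] / e.[k%:R] * (p.[(k + i)%:R] * F (k + i)%N)
      = (e.[k%:R])^-1 * \sum_(i < J) (w i).[k%:R] * F (k + i)%N.
    rewrite (big_ord_widen J (fun i =>
      (v`_i).[k%:R] / e.[k%:R] * (p.[(k + i)%:R] * F (k + i)%N))) //.
    rewrite big_mkcond mulr_sumr; apply: eq_bigr => i _.
    rewrite /w hornerM horner_shift natrD; case: ltnP => [_|/v0 ->]; first by ring.
    by rewrite horner0 !mul0r mulr0.
  have := GE n Nn; rewrite !ext => {}GE.
  have shift1E x : (shift 1 x).[n%:R] = x.[n.+1%:R] by rewrite horner_shift natr1.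
  have mSn i : (m i.+1).[n%:R] =
      e.[n%:R] * (w i).[n.+1%:R] - e.[n.+1%:R] * (w i.+1).[n%:R].
    rewrite /m; move: (w i) (w i.+1) => x y.
    by rewrite subr0 hornerD hornerN !hornerM !shift1E.
  have m0n : (m 0%N).[n%:R] =
      - (e.[n.+1%:R] * (w 0%N).[n%:R]) - e.[n%:R] * e.[n.+1%:R] * p.[n%:R].
    by rewrite /m; move: (w 0%N) => x; rewrite sub0r hornerD !hornerN !hornerM !shift1E.
  rewrite big_ord_recl /= m0n addn0.
  under eq_bigr do rewrite /bump /= add1n mSn addnS -addSn.
  have -> : \sum_(i < J) (e.[n%:R] * (w i).[n.+1%:R]
      - e.[n.+1%:R] * (w i.+1).[n%:R]) * F (n.+1 + i)%N
     = e.[n%:R] * (\sum_(i < J) (w i).[n.+1%:R] * F (n.+1 + i)%N)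
       - e.[n.+1%:R] * \sum_(i < J) (w i.+1).[n%:R] * F (n + i.+1)%N.
    rewrite !mulr_sumr -sumrB; apply: eq_bigr => i _; rewrite addnS addSn; ring.
  have wS : (w 0%N).[n%:R] * F n + \sum_(i < J) (w i.+1).[n%:R] * F (n + i.+1)%N
      = \sum_(i < J) (w i).[n%:R] * F (n + i)%N.
    have : \sum_(i < J.+1) (w i).[n%:R] * F (n + i)%N =
        \sum_(i < J) (w i).[n%:R] * F (n + i)%N.
      by rewrite big_ord_recr /= /w v0 // mul0r horner0 mul0r addr0.
    by rewrite big_ord_recl /= addn0.
  move: GE; rewrite -wS.
  set A := \sum_(_ < _) _; set B := \sum_(_ < _) _ => GE; apply/eqP.
  have -> : forall x y z t : K, (- (x * y) - z * x * t) * F n + (z * A - x * B)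
    = z * A - x * (y * F n + B) - z * x * (t * F n) by move=> *; ring.
  by rewrite GE; field; rewrite en en1.
move=> i iJ; apply: (mulfI T0); have := key i iJ.
by rewrite mulrCA => ->; rewrite mulrA.
Qed.

Lemma reduced_fraction p q : q != 0 -> exists r s : {poly K},
  [/\ s != 0, coprimep s r & p * s = r * q].
Proof.
move=> q0; have g0 : gcdp p q != 0 by rewrite gcdp_eq0 (negbTE q0) andbF.
exists (p %/ gcdp p q), (q %/ gcdp p q); split.
- by rewrite divp_eq0 negb_or q0 negb_or g0 -leqNgt /= dvdp_leq // dvdp_gcdr.
- by rewrite coprimep_sym coprimep_div_gcd // q0 orbT.
have cross (g x y : {poly K}) : x * g = p -> y * g = q -> p * y = x * q.
  by move=> <- <-; ring.
by apply: (cross (gcdp p q)); rewrite divpK ?dvdp_gcdl ?dvdp_gcdr.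
Qed.

Lemma divf_sub0 (E : fieldType) (x y u v : E) : x != 0 -> y != 0 ->
  (- (y * u) - x * y * v) / (x * y) = - (u / x) - v.
Proof. by move=> x0 y0; field; rewrite x0 y0. Qed.

Lemma divf_subS (E : fieldType) (x y u v : E) : x != 0 -> y != 0 ->
  (x * u - y * v) / (x * y) = - (v / x - u / y).
Proof. by move=> x0 y0; field; rewrite x0 y0. Qed.

(** The solution is c = m_J / (a_J e(n) e(n + 1)), reduced to r / q. Proportionality of [m] and [a]
    gives a_i c = m_i / (e(n) e(n + 1)), and the sum of the back-shifted terms telescopes. *)
Lemma rational_adjoint_solution a F (J : nat) p :
  holonomic_order F J -> size a = J.+1 -> annihilates a F -> a`_J != 0 ->
  p != 0 -> summable (fun n => p.[n%:R] * F n) ->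
  exists r q : {poly K}, [/\ q != 0, coprimep q r &
    \sum_(i < J.+1) (shift (- i%:R) (a`_i * r))%:F / (shift (- i%:R) q)%:F
      = (- p)%:F].
Proof.
move=> ordF sa aF aJ p0 sumG.
have [w [e [m [e0 wJ m0 mS mE]]]] := summable_operator ordF sa aF aJ p0 sumG.
have e10 : shift 1 e != 0 by rewrite shift_eq0.
have den0 : a`_J * (e * shift 1 e) != 0 by rewrite !mulf_neq0.
have [r [q [q0 co E]]] := reduced_fraction (m J) den0.
exists r, q; split=> //.
have mq i : (i <= J)%N -> m i * q = r * a`_i * (e * shift 1 e).
  move=> iJ; apply: (mulfI aJ); rewrite [LHS]mulrA mE // mulrAC E; ring.
(* [phi i] is the i-fold inverse shift, with values in the fraction field. *)
pose phi (i : nat) x := (shift (- i%:R) x)%:F.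
have phiM i x y : phi i (x * y) = phi i x * phi i y
  by rewrite /phi rmorphM /= tofracM.
have phiB i x y : phi i (x - y) = phi i x - phi i y
  by rewrite /phi rmorphB /= tofracB.
have phiN i x : phi i (- x) = - phi i x by rewrite /phi rmorphN /= tofracN.
have phi0 i x : x != 0 -> phi i x != 0 by rewrite /phi tofrac_eq0 shift_eq0.
have phiS i x : phi i.+1 (shift 1 x) = phi i x.
  by rewrite /phi shiftD -natr1 opprD addrCA subrr addr0.
have phi00 x : phi 0%N x = x%:F by rewrite /phi oppr0 shift0.
have term i : (i <= J)%N ->
    phi i (a`_i * r) / phi i q = phi i (m i) / (phi i e * phi i (shift 1 e)).
  move=> iJ; apply/eqP; rewrite eqr_div ?mulf_neq0 ?phi0 //.
  by rewrite -!phiM mq // (mulrC r).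
pose U i := phi i (w i) / phi i e.
transitivity (\sum_(i < J.+1) phi i (m i) / (phi i e * phi i (shift 1 e))).
  by apply: eq_bigr => i _; rewrite -term // -ltnS.
have t0 : phi 0%N (m 0%N) / (phi 0%N e * phi 0%N (shift 1 e)) = - U 0%N - p%:F.
  by rewrite m0 phiB phiN !phiM -(phi00 p) divf_sub0 ?phi0.
have tS (i : nat) :
    phi i.+1 (m i.+1) / (phi i.+1 e * phi i.+1 (shift 1 e)) = - (U i.+1 - U i).
  by rewrite mS phiB !phiM !phiS divf_subS ?phi0.
rewrite big_ord_recl t0.
rewrite (eq_bigr (fun i : 'I_J => - (U i.+1 - U i))) => [|i _]; last exact: tS.
(* The sum collapses to U 0 - U J, where U 0 cancels against the first term and U J = 0 because
   [w J = 0]. *)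
rewrite sumrN -(big_mkord xpredT (fun i => U i.+1 - U i)) telescope_sumr //.
by rewrite {2}/U wJ /phi rmorph0 tofrac0 mul0r tofracN sub0r opprK addrAC addNr add0r.
Qed.

(** After clearing denominators, every summand but the i-th, and also the right side, contains the
    factor [y i]. *)
Lemma dvdp_fraction_sum (I : finType) (x y : I -> {poly K}) z :
  (forall i, y i != 0) -> \sum_i (x i)%:F / (y i)%:F = z%:F ->
  forall i, y i %| x i * \prod_(j | j != i) y j.
Proof.
move=> y0 E i.
have {}E : \sum_i x i * \prod_(j | j != i) y j = z * \prod_j y j.
  apply/eqP; rewrite -tofrac_eq; apply/eqP.
  rewrite tofracM -E mulr_suml rmorph_sum /=; apply: eq_bigr => k _.
  rewrite [in RHS](bigD1 k) //= !tofracM.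
  by rewrite [RHS]mulrA divfK // tofrac_eq0.
move: E; rewrite (bigD1 i) //= => /(canRL (addrK _)) ->.
rewrite dvdp_subr; last by rewrite (bigD1 i) //= mulrCA dvdp_mulr.
apply: (big_ind (fun t => y i %| t)) => [|s t|k ki]; first exact: dvdp0.
  exact: dvdp_add.
by rewrite (bigD1 i) 1?eq_sym //= mulrCA dvdp_mulr.
Qed.

End Telescoper.

(** * Polynomial solution of the adjoint equation and the degree bound *)

Lemma polynomial_adjoint_solution (K : fieldType) (Kchar0 : [pchar K] =i pred0)
  (F : nat -> K) (J : nat) (a : seq {poly K}) (p : {poly K}) :
  (0 < J)%N -> holonomic_order F J -> size a = J.+1 -> annihilates a F ->
  a`_J != 0 ->
  (forall h : nat, coprimep a`_0 (a`_J \Po ('X + h%:R%:P))) ->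
  p != 0 -> summable (fun n => p.[n%:R] * F n) ->
  exists c : {poly K}, adjoint a c = - p.
Proof.
move=> J0 ordF sa aF aJ co p0 sumG.
have [r [q [q0 cqr E]]] := rational_adjoint_solution ordF sa aF aJ p0 sumG.
have y0 (i : 'I_J.+1) : shift (- i%:R) q != 0 by rewrite shift_eq0.
have dvd := dvdp_fraction_sum y0 E.
have q1 : size q = 1%N.
  apply: (denominator_trivial Kchar0 J0 aJ q0 co).
    (* The summand i = 0; coprimality of [q] and [r] removes the numerator [r]. *)
    have := dvd ord0; rewrite /= oppr0 !shift0 (mulrC a`_0) -mulrA Gauss_dvdpr //.
    by rewrite big_mkcond big_ord_recl /= mul1r.
  (* The summand i = J, translated by J so that its denominator becomes [q]; the product is then
     reversed. *)
  have := dvdp_shift J%:R (dvd ord_max).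
  rewrite rmorphM /= !shiftD addNr !shift0 (mulrC _ r) -mulrA Gauss_dvdpr //.
  rewrite big_mkcond big_ord_recr /= eqxx mulr1 rmorph_prod /=.
  rewrite (reindex_inj rev_ord_inj) /=.
  rewrite (eq_bigr (fun i : 'I_J => shift i.+1%:R q)) // => i _.
  rewrite ifT; last by rewrite -val_eqE /= neq_ltn ltn_subrL J0.
  by rewrite shiftD natrB // opprB subrK.
have /size_poly1P [k k0 qk] : size q == 1%N by rewrite q1.
exists (k^-1 *: r); apply/eqP; rewrite -tofrac_eq -E /adjoint sa rmorph_sum /=.
apply/eqP/eq_bigr => i _; apply: (canRL (mulfK _)); first by rewrite tofrac_eq0.
rewrite -tofracM -rmorphM /= qk mulrC mul_polyC -scalerAr scalerA mulfV ?scale1r //.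
Qed.

Unset Implicit Arguments.
Set Strict Implicit.

Theorem theorem2p6 (K : fieldType) (Kchar0 : [pchar K] =i pred0)
  (F : nat -> K) (J : nat) (a : seq {poly K}) (C : nat) (p : {poly K}) :
  (0 < J)%N ->
  holonomic_order F J ->
  size a = J.+1 ->
  annihilates a F ->
  a`_0 * a`_J != 0 ->
  (forall h : nat, coprimep a`_0 (a`_J \Po ('X + h%:R%:P))) ->
  nondegenerated a ->
  is_CL a C ->
  p != 0 ->
  summable (fun n => p.[n%:R] * F n) ->
  degL a + C%:Z <= ideg p.
Proof.
move=> J0 ordF sa aF a0J co nd [_ Cmin] p0 sumG.
have aJ : a`_J != 0 by apply: contraNneq a0J => ->; rewrite mulr0.
have [D aD] := nondegenerated_degL sa nd.
(* A positive [C] would give L^*(1) = 0, whereas its coefficient at n^D is f(0). *)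
have -> : C = 0%N.
  case: C Cmin => // C /(_ 0%N isT); rewrite adjoint_pow expr0 => adj0.
  have := coef_adjoint sa aD (size_poly1 K); rewrite adj0 coef0 lead_coef1 mul1r.
  by move/esym/eqP; rewrite (negbTE (nd 0%N)).
have [c Ec] := polynomial_adjoint_solution Kchar0 J0 ordF sa aF aJ co p0 sumG.
have c0 : c != 0.
  apply: contraNneq p0 => c0; rewrite -oppr_eq0 -Ec c0 /adjoint big1 // => i _.
  by rewrite mulr0 rmorph0.
have sc : size c = (size c).-1.+1 by rewrite prednK // size_poly_gt0.
have top := coef_adjoint sa aD sc.
(* The coefficient of -p at this exponent is lc(c) f(deg c), nonzero by nondegeneracy. *)
have : (D + (size c).-1 < size p)%N.
  rewrite -(size_polyN p) -Ec ltnNge; apply/negP => /(nth_default 0).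
  move/eqP; rewrite top mulf_eq0 lead_coef_eq0 (negbTE c0) /=.
  by rewrite (negbTE (nd _)).
rewrite aD addr0 /ideg lerBrDr -PoszD lez_nat addn1; apply: leq_trans.
by rewrite ltnS leq_addr.
Qed.
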